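(* Let $d \ge 1$ and let $\alpha=(\alpha_1,\ldots,\alpha_d) \in \mathbb{R}^d$ be badly approximable, i.e. $\inf_{n \in \mathbb{Z}^d \setminus \{ 0 \}} \| n \|_{\infty}^d \cdot \| n_1 \alpha_1 + \cdots +n_d \alpha_d \| >0$. Then for any integer $N \ge 1$, \[ \sum_{n \in [-N,N]^d \setminus \{ 0\} } \frac{1}{\| n_1 \alpha_1 + \cdots + n_d \alpha_d \|} = d\, 2^{d+1} N^d \log N + O(N^d), \qquad \sum_{n \in [-N,N]^d \setminus \{ 0\} } \frac{1}{\| n \|_{\infty}^d \cdot \| n_1 \alpha_1 + \cdots + n_d \alpha_d \|} = d^2 2^d (\log N)^2 + O(\log N), \] where the sums are over integer vectors $n=(n_1,\ldots,n_d)$, with implied constants depending only on $\alpha$.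
   Context: $\| x \|$ denotes the distance from $x \in \mathbb{R}$ to the nearest integer, and $\| n \|_{\infty} = \max_{1 \le k \le d} |n_k|$ for $n \in \mathbb{Z}^d$. In error terms, $\log x$ means $\log \max\{e,x\}$. *)

(* Defs.v *)
From mathcomp Require Import all_boot all_order all_algebra.
From mathcomp Require Import all_classical all_reals all_analysis.

Set Implicit Arguments.
Unset Strict Implicit.
Unset Printing Implicit Defensive.

Import Order.TTheory GRing.Theory Num.Theory.
Import numFieldNormedType.Exports.

Local Open Scope classical_set_scope.
Local Open Scope ring_scope.

Definition dist_int (R : realType) (x : R) : R :=
  inf [set `|x - m%:~R| | m in [set: int]].

Definition linform (R : realType) (d : nat) (alpha : 'rV[R]_d)
    (n : 'rV[int]_d) : R :=
  \sum_(k < d) (n ord0 k)%:~R * alpha ord0 k.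

Definition supnorm (d : nat) (n : 'rV[int]_d) : nat :=
  \max_(k < d) `|n ord0 k|%N.

(* The set below is bounded below by 0, and nonempty when 0 < d, so that for
   such d the real-valued inf is the genuine infimum. *)
Definition badly_approximable (R : realType) (d : nat) (alpha : 'rV[R]_d) :
    Prop :=
  0 < inf [set (supnorm n)%:R ^+ d * dist_int (linform alpha n)
          | n in [set n : 'rV[int]_d | n != 0]].

Definition box0 (d N : nat) : set 'rV[int]_d :=
  [set n | n != 0 /\ forall k, - N%:Z <= n ord0 k <= N%:Z].
Arguments box0 : clear implicits.

(* Hence the finitely supported sums \sum_(n \in box0 d N) are the usual sums
   over the box. *)
Lemma finite_box0 (d N : nat) : finite_set (box0 d N).
Proof.
pose g (v : {ffun 'I_d -> 'I_(N + N).+1}) : 'rV[int]_d :=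
  \row_k ((v k : nat)%:Z - N%:Z).
apply: (@sub_finite_set _ _ (g @` setT)); last first.
  by apply: finite_image; exact: finite_finset.
move=> n [_ h]; exists [ffun k => inord (absz (n ord0 k + N%:Z))] => //.
apply/rowP => k; rewrite mxE ffunE.
have /andP[h1 h2] := h k.
have p : 0 <= n ord0 k + N%:Z by rewrite -lerBlDr sub0r.
rewrite inordK; first by rewrite gez0_abs // addrK.
by rewrite ltnS -lez_nat gez0_abs // PoszD lerD2r.
Qed.

(* Main.v *)
Require Import Defs.
From mathcomp Require Import all_boot all_order all_algebra.
From mathcomp Require Import all_classical all_reals all_analysis.
From mathcomp Require Import zify ring lra.

Import Order.TTheory GRing.Theory Num.Theory.
Import numFieldNormedType.Exports.

Local Open Scope classical_set_scope.
Local Open Scope ring_scope.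

Set Implicit Arguments.
Unset Strict Implicit.
Unset Printing Implicit Defensive.

(* Write {x} for the fractional part. Since 1/||x|| = 1/{x} + 1/{-x} + O(1), the
   symmetry n -> -n reduces the first sum to twice the sum of 1/{n.alpha}, and
   1/u is up to O(1) the number of q >= 1 with u < 1/q. So one needs the number
   of n in the box with {n.alpha} < 1/q, for q up to a constant times N^d.
   Comparing the q arcs [i/q, (i+1)/q), whose counts add up to (2N+1)^d exactly,
   this number is (2N+1)^d / q + O((N/M)^d) with M^(d+1) about N q: any two arcs
   differ by a translation, which modulo 1 is within O(1/M^d) of some k.alpha
   with |k| = O(M) (covering), and shifting n by k affects only points in boundary
   layers, which are few because the n.alpha are well spaced (packing). The errors
   add up to O(N^d) and the main terms to (2N+1)^d log(N^d). The second sum follows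
   by partial summation. *)

(** * Fractional parts and the distance to the nearest integer *)

Section FractionalPart.
Variable R : realType.
Implicit Types (x y : R) (m : int).

Definition fpart x : R := x - (Num.floor x)%:~R.

Lemma fpart_ge0 x : 0 <= fpart x.
Proof. by rewrite /fpart subr_ge0 floor_le. Qed.

Lemma fpart_lt1 x : fpart x < 1.
Proof. by rewrite /fpart ltrBlDl -[X in _ + X]/(1%:~R) -intrD floorD1_gt. Qed.

Lemma fpartB x m : fpart (x - m%:~R) = fpart x.
Proof.
rewrite /fpart -intrN floorDrz ?intr_int// intrKfloor !intrD opprD.
by rewrite addrACA subrr addr0.
Qed.

Lemma fpart_small x : 0 <= x < 1 -> fpart x = x.
Proof. by move=> h; rewrite /fpart (floor_def (m := 0)) ?subr0. Qed.

Lemma fpart_le x m : 0 <= x - m%:~R -> fpart x <= x - m%:~R.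
Proof.
move=> h; rewrite /fpart lerD2l lerN2 ler_int floor_ge_int.
by rewrite -subr_ge0.
Qed.

Lemma fpartE x : exists m, fpart x = x - m%:~R.
Proof. by exists (Num.floor x). Qed.

Lemma dist_int_le x m : dist_int x <= `|x - m%:~R|.
Proof. by apply: ge_inf; [exists 0 => _ [k _ <-] | exists m]. Qed.

Lemma dist_int_fpart x : dist_int x = Num.min (fpart x) (1 - fpart x).
Proof.
apply/eqP; rewrite eq_le; apply/andP; split; last first.
  apply: lb_le_inf; first by exists `|x - 0%:~R|; exists 0.
  move=> _ [m _ <-].
  have [h0 h1] := (fpart_ge0 x, fpart_lt1 x).
  have e : x = (Num.floor x)%:~R + fpart x by rewrite /fpart addrC subrK.
  have [h|h] := leP m (Num.floor x).
    have : (m%:~R : R) <= (Num.floor x)%:~R by rewrite ler_int.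
    have := ler_norm (x - m%:~R).
    by rewrite ge_min => A B; apply/orP; left; lra.
  have : ((Num.floor x + 1)%:~R : R) <= m%:~R by rewrite ler_int lezD1.
  have := ler_norm (- (x - m%:~R)).
  rewrite normrN intrD ge_min => A B; apply/orP; right.
  by have : (1%:~R : R) = 1 by []; lra.
rewrite le_min; apply/andP; split.
  by apply: le_trans (dist_int_le x (Num.floor x)) _; rewrite ger0_norm ?fpart_ge0.
apply: le_trans (dist_int_le x (Num.floor x + 1)) _.
rewrite intrD opprD addrA -/(fpart x) distrC ger0_norm//.
by rewrite subr_ge0 ltW// fpart_lt1.
Qed.

Lemma fpartN x : fpart x != 0 -> fpart (- x) = 1 - fpart x.
Proof.
move=> x0; have x1 : 0 < fpart x by rewrite lt_def x0 fpart_ge0.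
rewrite -(@fpartB (- x) (- (Num.floor x + 1))) fpart_small.
  by rewrite /fpart !intrN intrD; lra.
have := fpart_lt1 x; rewrite /fpart !intrN intrD in x1 *.
by have : (1%:~R : R) = 1 by []; lra.
Qed.

(* For 0 < u < 1, 1/u + 1/(1-u) and 1/min(u,1-u) differ by 1/max(u,1-u). *)
Lemma dist_int_inv x : fpart x != 0 ->
  `|(dist_int x)^-1 - ((fpart x)^-1 + (fpart (- x))^-1)| <= 2.
Proof.
move=> x0; rewrite fpartN// dist_int_fpart.
have u0 : 0 < fpart x by rewrite lt_def x0 fpart_ge0.
have u1 := fpart_lt1 x; move: (fpart x) u0 u1 => u u0 u1.
have v0 : 0 < 1 - u by lra.
have key (t : R) : 2^-1 <= t -> `|- t^-1| <= 2.
  move=> ht; have t0 : 0 < t by lra.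
  rewrite normrN ger0_norm; last by rewrite invr_ge0 ltW.
  by rewrite -[leRHS]invrK lef_pV2// posrE// invr_gt0.
have [h|h] := leP u (1 - u).
  by rewrite opprD addrA subrr sub0r; apply: key; lra.
by rewrite opprD addrCA subrr addr0; apply: key; lra.
Qed.

(** The arcs [i/q, (i+1)/q) partition the circle, and x falls in the one whose index is the integer
    part of q {x}. Summing booleans as numbers suits the double counting in [sum_arc_count]. *)
Lemma fpart_interval x (q : nat) : (0 < q)%N ->
  (\sum_(i < q) (fpart (x - i%:R / q%:R) < q%:R^-1)%R)%N = 1%N.
Proof.
move=> q0; have q0R : 0 < (q%:R : R) by rewrite ltr0n.
have u0 := fpart_ge0 x; have u1 := fpart_lt1 x.
have tlt : (Num.truncn (fpart x * q%:R) < q)%N.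
  by rewrite truncn_lt_nat ?mulr_ge0// ?ltW// gtr_pMl.
have /andP[t1 t2] := truncn_itv (mulr_ge0 u0 (ltW q0R)).
pose i0 := Ordinal tlt.
rewrite (bigD1 i0)//= big1 ?addn0 => [|i ii0].
  rewrite (_ : (_ < _) = true)//.
  rewrite -(fpartB _ (Num.floor x)) addrAC -/(fpart x) fpart_small.
    by rewrite ltrBlDl -[X in _ + X]mul1r -mulrDl ltr_pdivlMr// -[1]/(1%:R) -natrD addn1.
  rewrite subr_ge0 ler_pdivrMr// t1/=.
  by rewrite (le_lt_trans _ u1)// gerBl divr_ge0// ltW.
apply/eqP; rewrite eqb0 -leNgt.
rewrite -(fpartB _ (Num.floor x)) addrAC -/(fpart x).
have iq : (i%:R + 1 : R) <= q%:R by rewrite -[1]/(1%:R) -natrD ler_nat addn1.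
have [h|h] := leP (i%:R / q%:R) (fpart x).
  rewrite fpart_small.
    rewrite lerBrDr -[X in X + _]mul1r -mulrDl ler_pdivrMr//.
    rewrite -[1]/(1%:R) -natrD; apply: le_trans t1.
    rewrite ler_nat add1n.
    rewrite ler_pdivrMr// in h.
    have : (i%:R : R) < (Num.truncn (fpart x * q%:R)).+1%:R by apply: le_lt_trans t2.
    rewrite ltr_nat ltnS leq_eqVlt => /orP[/eqP e|//].
    by case/negP: ii0; apply/eqP/val_inj.
  by rewrite subr_ge0 h/= (le_lt_trans _ u1)// gerBl divr_ge0// ltW.
(* For i/q > {x} the difference wraps around to {x} - i/q + 1, which is at least 1/q because i + 1
   <= q. *)
rewrite -(fpartB _ (-1)) intrN opprK fpart_small.
  have : i%:R / q%:R + q%:R^-1 <= 1 :> R.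
    by rewrite -[X in _ + X]mul1r -mulrDl ler_pdivrMr// mul1r.
  by have : (1%:~R : R) = 1 by []; lra.
have : i%:R / q%:R <= 1 :> R by rewrite ler_pdivrMr// mul1r; lra.
by have : (1%:~R : R) = 1 by []; lra.
Qed.

End FractionalPart.

(** * Integer boxes, well-spaced linear forms and packing *)

Section Boxes.
Variables (R : realType) (d : nat).
Implicit Types (alpha : 'rV[R]_d) (n : 'rV[int]_d).

Lemma linformD alpha n k :
  linform alpha (n + k) = linform alpha n + linform alpha k.
Proof.
by rewrite /linform -big_split/=; apply: eq_bigr => j _; rewrite mxE intrD mulrDl.
Qed.

Lemma linformN alpha n : linform alpha (- n) = - linform alpha n.
Proof.
by rewrite /linform -sumrN; apply: eq_bigr => j _; rewrite mxE intrN mulNr.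
Qed.

Lemma linform0 alpha : linform alpha 0 = 0.
Proof. by rewrite /linform big1// => j _; rewrite mxE mul0r. Qed.

Lemma supnormP n (M : nat) :
  reflect (forall k, (`|n ord0 k| <= M)%N) (supnorm n <= M)%N.
Proof.
apply: (iffP (bigmax_leqP _ _ _)) => h k; first exact: h.
by move=> _; exact: h.
Qed.

(** Bad approximability in integer form: Q will be an integer above the inverse of the infimum, and
    M is any bound for the norm, so that cells of width 1 / (Q M^d) can be counted by natural
    numbers. *)
Definition well_spaced alpha (Q : nat) := forall n, n != 0 ->
  forall M : nat, (supnorm n <= M)%N ->
  forall m : int, 1 <= (Q * M ^ d)%:R * `|linform alpha n - m%:~R|.

Lemma badly_approximable_well_spaced alpha : badly_approximable alpha ->
  exists2 Q, (0 < Q)%N & well_spaced alpha Q.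
Proof.
rewrite /badly_approximable; set c := inf _ => c0.
exists (Num.truncn c^-1).+1 => // n n0 M nM m.
have h : c <= M%:R ^+ d * `|linform alpha n - m%:~R|.
  apply: (@le_trans _ _ ((supnorm n)%:R ^+ d * dist_int (linform alpha n))).
    apply: ge_inf; last by exists n.
    exists 0 => _ [k _ <-]; rewrite mulr_ge0 ?exprn_ge0//.
    by rewrite dist_int_fpart le_min fpart_ge0/= subr_ge0 ltW// fpart_lt1.
  apply: ler_pM; rewrite ?exprn_ge0//; last exact: dist_int_le.
    by rewrite dist_int_fpart le_min fpart_ge0/= subr_ge0 ltW// fpart_lt1.
  by rewrite lerXn2r ?nnegrE// ler_nat.
rewrite natrM natrX -mulrA; apply: le_trans (_ : c^-1 * c <= _).
  by rewrite mulVf// gt_eqF.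
apply: ler_pM => //; first by rewrite invr_ge0 ltW.
- exact: ltW.
- exact/ltW/truncnS_gt.
Qed.

(* Two points in the same cell of a grid of mesh M in the first d coordinates
   and 1 / (Q M^d) in the last one coincide. *)
Lemma packing alpha Q (M : nat) (s : seq 'rV[int]_d) (lo : 'I_d -> int)
    (L : 'I_d -> nat) (x : R) (l : nat) :
  well_spaced alpha Q -> (0 < M)%N -> uniq s ->
  (forall n, n \in s -> forall j,
     lo j <= n ord0 j < lo j + ((L j).+1 * M)%N%:Z) ->
  (forall n, n \in s -> fpart (linform alpha n - x) * (Q * M ^ d)%:R < l%:R) ->
  (size s <= (\prod_j (L j).+1) * l)%N.
Proof.
move=> ws M0 us hlo hl.
have [->//|l0] := eqVneq s [::].
have {l0} l0 : (0 < l)%N.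
  case: s l0 {us hlo} hl => // n s _ /(_ n (mem_head _ _)) h.
  rewrite -(ltr_nat R); apply: le_lt_trans h.
  by rewrite mulr_ge0// fpart_ge0.
case: l l0 hl => // l _ hl.
pose t n : nat := Num.truncn (fpart (linform alpha n - x) * (Q * M ^ d)%:R).
pose c n (j : 'I_d) : nat := (`|n ord0 j - lo j| %/ M)%N.
pose f n : {dffun forall j : 'I_d, 'I_(L j).+1} * 'I_l.+1 :=
  ([ffun j => inord (c n j)], inord (t n)).
have fE n n' : n \in s -> n' \in s -> f n = f n' ->
    (forall j, c n j = c n' j) /\ t n = t n'.
  move=> ns ns' [e1 e2].
  have cl u : u \in s -> forall j, (c u j < (L j).+1)%N.
    by move=> us' j; rewrite ltn_divLR//; have := hlo u us' j; lia.
  have tl u : u \in s -> (t u < l.+1)%N.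
    move=> us'; rewrite truncn_lt_nat ?hl//.
    by rewrite mulr_ge0// fpart_ge0.
  split; last first.
    by move/(congr1 val): e2; rewrite /= !inordK ?tl.
  move=> j; move/ffunP: e1 => /(_ j); rewrite !ffunE => /(congr1 val).
  by rewrite /= !inordK ?cl.
have finj : {in s &, injective f}.
  move=> n n' ns ns' /(fE _ _ ns ns')[e1 e2].
  apply/eqP; rewrite -subr_eq0; apply/negPn/negP => nz.
  have nM : (supnorm (n - n')%R <= M)%N.
    apply/supnormP => k; rewrite !mxE.
    have := e1 k; rewrite /c => e; have /andP[+ _] := hlo n ns k; have /andP[+ _] := hlo n' ns' k.
    have := divn_eq (`|n ord0 k - lo k|) M; have := divn_eq (`|n' ord0 k - lo k|) M.
    rewrite e; have := ltn_pmod (`|n ord0 k - lo k|) M0.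
    have := ltn_pmod (`|n' ord0 k - lo k|) M0.
    move: (_ %% _)%N => a; move: (_ %% _)%N => b; move: (_ %/ _ * _)%N => z.
    by move: (n ord0 k) (n' ord0 k) (lo k) => u v w; clear; lia.
  have [m hm] := fpartE (linform alpha n - x).
  have [m' hm'] := fpartE (linform alpha n' - x).
  have := ws _ nz _ nM (m - m'); rewrite linformD linformN intrB.
  set a := fpart _ in hm; set a' := fpart _ in hm'.
  have -> : linform alpha n - linform alpha n' - (m%:~R - m'%:~R) = a - a'.
    by rewrite hm hm'; ring.
  have W0 : 0 <= (Q * M ^ d)%:R :> R by [].
  rewrite -[X in X * `|_|]ger0_norm// -normrM mulrBr.
  have := truncn_itv (mulr_ge0 (fpart_ge0 (linform alpha n - x)) W0).
  have := truncn_itv (mulr_ge0 (fpart_ge0 (linform alpha n' - x)) W0).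
  rewrite -!/(t _) e2 -/a -/a' => /andP[h1 h2] /andP[h3 h4].
  apply/negP; rewrite -ltNge ltr_norml ![_%:R * _]mulrC.
  by rewrite -natr1 in h2 h4; apply/andP; split; lra.
rewrite -(size_map f).
have um : uniq (map f s) by rewrite map_inj_in_uniq.
have := max_card (mem (map f s)); rewrite (card_uniqP um).
by rewrite card_prod card_ord card_dep_ffun foldrE big_map big_enum/=;
  under eq_bigr do rewrite card_ord.
Qed.

(** A duplicate-free enumeration that keeps 0, so that the q arc counts add up to exactly
    (2N+1)^d. *)
Definition box (N : nat) : seq 'rV[int]_d :=
  [seq \row_j ((v j : nat)%:Z - N%:Z) | v : {ffun 'I_d -> 'I_(N + N).+1}].

Lemma size_box N : size (box N) = ((N + N).+1 ^ d)%N.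
Proof. by rewrite size_map -cardE card_ffun !card_ord. Qed.

Lemma box_uniq N : uniq (box N).
Proof.
rewrite map_inj_uniq ?enum_uniq// => v w /rowP e; apply/ffunP => j.
by have := e j; rewrite !mxE => /addIr [/val_inj].
Qed.

Lemma mem_box N n : (n \in box N) = (supnorm n <= N)%N.
Proof.
apply/mapP/supnormP => [[v _ ->] k|h].
  by rewrite mxE; have := ltn_ord (v k); move: (nat_of_ord _) => w; clear; lia.
exists [ffun k => inord (absz (n ord0 k + N%:Z))]; first by rewrite mem_enum.
apply/rowP => k; rewrite mxE ffunE; have := h k; move: (n ord0 k) => u; clear => hk.
by rewrite inordK; lia.
Qed.

(* The condition n != 0 in box0 compares n with 0 as a function of two indices. *)
Lemma box0E N : box0 d N = [set` [seq n <- box N | n != 0]].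
Proof.
have neq0 n : (n : 'I_1 -> 'I_d -> int) = 0 -> n = 0.
  by move=> e; apply/matrixP => i j; rewrite e mxE.
apply/seteqP; split => n /=; rewrite mem_filter mem_box.
  move=> [/eqP n0 h]; apply/andP; split.
    by apply/eqP => e; apply: n0; rewrite e; apply/funext => i; apply/funext => j; rewrite mxE.
  by apply/supnormP => k; move: (h k); move: (n ord0 k) => u; clear; lia.
move=> /andP[/eqP n0 /supnormP h]; split; first by apply/eqP => /neq0.
by move=> k; move: (h k); move: (n ord0 k) => u; clear; lia.
Qed.

Lemma sum_box0 N (F : 'rV[int]_d -> R) :
  \sum_(n \in box0 d N) F n = \sum_(n <- box N | n != 0) F n.
Proof.
by rewrite box0E -fsbig_seq ?filter_uniq ?box_uniq// big_filter.
Qed.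

Lemma perm_boxN N : perm_eq (map -%R (box N)) (box N).
Proof.
apply: uniq_perm; [|exact: box_uniq|].
  by rewrite map_inj_uniq ?box_uniq//; exact: oppr_inj.
move=> n; rewrite mem_box; apply/mapP/idP => [[k kN ->]|h].
  by move: kN; rewrite mem_box => /supnormP h; apply/supnormP => j; rewrite mxE abszN.
exists (- n); last by rewrite opprK.
by rewrite mem_box; apply/supnormP => j; move/supnormP: h => /(_ j); rewrite mxE abszN.
Qed.

End Boxes.

(** * Covering the circle by values of the linear form at small vectors *)

Section Covering.
Variables (R : realType) (d : nat) (alpha : 'rV[R]_d).

(** Approximation modulo 1 in j steps, each step adding a vector of norm at most M and an error of
    at most 1 / M^d. *)
Definition reachable (M j : nat) (x : R) := exists k : 'rV[int]_d,
  exists m : int, (supnorm k <= j * M)%N /\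
    `|linform alpha k - m%:~R - x| * (M ^ d)%:R <= j%:R.

Lemma reachable0 M : reachable M 0 0.
Proof.
exists 0, 0; split; first by apply/supnormP => i; rewrite mxE.
by rewrite linform0 !subr0 normr0 mul0r.
Qed.

Lemma reachable_le M i j x : (i <= j)%N -> reachable M i x -> reachable M j x.
Proof.
move=> ij [k [m [h1 h2]]]; exists k, m; split.
  by rewrite (leq_trans h1)// leq_mul2r ij orbT.
by rewrite (le_trans h2)// ler_nat.
Qed.

Lemma reachable_step M j x y (k : 'rV[int]_d) (m : int) : (supnorm k <= M)%N ->
  `|y - x - (linform alpha k - m%:~R)| * (M ^ d)%:R <= 1 ->
  reachable M j x -> reachable M j.+1 y.
Proof.
move=> kM h [k0 [m0 [h1 h2]]]; exists (k0 + k), (m0 + m); split.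
  apply/supnormP => i; rewrite mxE.
  move/supnormP: kM => /(_ i); move/supnormP: h1 => /(_ i).
  by move: (k ord0 i) (k0 ord0 i) => u v; rewrite mulSn; lia.
rewrite linformD intrD -natr1.
apply: le_trans (lerD h2 h); rewrite -mulrDl ler_wpM2r//.
apply: le_trans (ler_normB _ _); rewrite le_eqVlt; apply/orP; left.
by apply/eqP; congr `|_|; ring.
Qed.

(* If the points of the grid of mesh 1/M^d were not all reachable within 2Q+1
   steps, then each rank up to that bound would be attained; points x_j of rank
   2j+1 for j <= Q give (Q+1) M^d points x_j + k.alpha, 0 <= k < M, which are
   1/(Q M^d)-separated modulo 1. *)
Lemma covering Q M (x : R) : well_spaced alpha Q -> (0 < Q)%N -> (0 < M)%N ->
  reachable M Q.*2.+1 x.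
Proof.
move=> ws Q0 M0; pose g (i : nat) : R := i%:R / (M ^ d)%:R.
have Md0 : 0 < (M ^ d)%:R :> R by rewrite ltr0n expn_gt0 M0.
(* If the step from 2j to 2j+1 gains no grid point, then all grid points are reachable in 2j steps:
   0 is, and passing to the next grid point costs one step with the zero vector. One more such step
   leads from the grid point below {x} to {x}. *)
suff [j jQ hj] : exists2 j, (j <= Q)%N &
    forall i, reachable M j.*2.+1 (g i) -> reachable M j.*2 (g i).
  have hg i : reachable M j.*2 (g i).
    elim: i => [|i IH].
      by apply: (@reachable_le _ 0) => //; rewrite /g mul0r; exact: reachable0.
    apply: hj; apply: (@reachable_step _ _ (g i) _ 0 0) => //.
      by apply/supnormP => k; rewrite mxE.
    rewrite linform0 !subr0 /g -mulrBl -natr1 addrAC subrr add0r.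
    by rewrite ger0_norm ?divr_ge0// divfK// gt_eqF.
  suff [k [m [h1 h2]]] : reachable M Q.*2.+1 (fpart x).
    have [m' e] := fpartE x.
    exists k, (m - m'); split => //; rewrite (le_trans _ h2)// e intrB.
    by rewrite (_ : _ - _ - x = linform alpha k - m%:~R - (x - m'%:~R))//; ring.
  apply: (@reachable_le _ j.*2.+1); first by rewrite ltnS leq_double.
  have t0 : 0 <= fpart x * (M ^ d)%:R by rewrite mulr_ge0// fpart_ge0.
  have /andP[t1 t2] := truncn_itv t0; set i := Num.truncn _ in t1 t2.
  apply: (@reachable_step _ _ (g i) _ 0 0) (hg i).
    by apply/supnormP => k; rewrite mxE.
  rewrite linform0 !subr0 -[X in _ * X]gtr0_norm// -normrM mulrBl /g divfK ?gt_eqF//.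
  by rewrite -natr1 in t2; rewrite ger0_norm; lra.
apply: contrapT => hno.
have /choice[f hf] (j : 'I_Q.+1) : exists i : nat,
    reachable M j.*2.+1 (g i) /\ ~ reachable M j.*2 (g i).
  apply: contrapT => h; apply: hno; exists j; first by rewrite -ltnS.
  by move=> i h1; apply: contrapT => h2; apply: h; exists i.
pose v (k : {ffun 'I_d -> 'I_M}) : 'rV[int]_d := \row_i (k i)%:Z.
pose W : nat := (Q * M ^ d)%N.
have W0 : (0 < W)%N by rewrite muln_gt0 Q0 expn_gt0 M0.
pose y (p : 'I_Q.+1 * {ffun 'I_d -> 'I_M}) : R := g (f p.1) + linform alpha (v p.2).
have yW p : (Num.truncn (fpart (y p) * W%:R) < W)%N.
  rewrite truncn_lt_nat ?mulr_ge0// ?fpart_ge0// gtr_pMl ?fpart_lt1//.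
  by rewrite ltr0n.
have vM k k' : (supnorm (v k - v k')%R <= M)%N.
  apply/supnormP => i; rewrite !mxE; have := ltn_ord (k i); have := ltn_ord (k' i).
  by move: (nat_of_ord _) (nat_of_ord _) => a b; lia.
(* Pigeonhole: there are (Q+1) M^d points [y p] and only [W] = Q M^d cells of width 1/[W], so a
   contradiction follows once [c] is injective. *)
have [c cy] : exists c : 'I_Q.+1 * {ffun 'I_d -> 'I_M} -> 'I_W,
    forall p p', c p = c p' -> exists m : int, `|y p - y p' - m%:~R| * W%:R < 1.
  exists (fun p => Ordinal (yW p)) => p p'.
  move=> /(congr1 val)/= e; have [m e1] := fpartE (y p); have [m' e2] := fpartE (y p').
  exists (m - m'); rewrite intrB.
  rewrite (_ : _ - _ - _ = fpart (y p) - fpart (y p')); last by rewrite e1 e2; ring.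
  rewrite -[X in _ * X]ger0_norm// -normrM mulrBl.
  have := truncn_itv (mulr_ge0 (fpart_ge0 (y p)) (ler0n R W)).
  have := truncn_itv (mulr_ge0 (fpart_ge0 (y p')) (ler0n R W)).
  rewrite e => /andP[h1 h2] /andP[h3 h4].
  by rewrite ltr_norml -natr1 in h2 h4 *; apply/andP; split; lra.
(* A shared cell would lead from the point of lower rank to the other in one step, with vector
   [v p.2 - v p'.2], hence in 2 [p.1] + 2 <= 2 [p'.1] steps in all. This is why the ranks are spaced
   by two. *)
have nlt (p p' : 'I_Q.+1 * {ffun 'I_d -> 'I_M}) : (p.1 < p'.1)%N -> c p <> c p'.
  move=> lt /cy[m hm]; have [r1 _] := hf p.1; have [_ r2] := hf p'.1.
  apply: r2; apply: (@reachable_le _ p.1.*2.+2).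
    by rewrite -doubleS leq_double.
  apply: (@reachable_step _ _ (g (f p.1)) _ (v p.2 - v p'.2) m) r1; first exact: vM.
  rewrite (_ : _ - _ - _ = - (y p - y p' - m%:~R)); last first.
    by rewrite /y linformD linformN; ring.
  rewrite normrN; apply: le_trans (ltW hm).
  by rewrite ler_wpM2l// ler_nat leq_pmull.
have cinj : injective c.
  move=> p p' e; have e1 : p.1 = p'.1.
    have [lt|lt|/val_inj//] := ltngtP p.1 p'.1.
      by case: (nlt p p' lt e).
    by case: (nlt p' p lt (esym e)).
  have [m] := cy _ _ e; rewrite /y e1 (_ : _ - _ - _ =
      linform alpha (v p.2 - v p'.2) - m%:~R); last by rewrite linformD linformN; ring.
  have [nz|nz] := eqVneq (v p.2 - v p'.2) 0; last first.
    have := ws _ nz _ (vM _ _) m.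
    by rewrite mulrC -/W => h1 h2; have := le_lt_trans h1 h2; rewrite ltxx.
  move=> _; case: p p' e1 {e} nz => [a b] [a' b']/= -> /eqP.
  rewrite subr_eq0 => /eqP/rowP h; congr pair; apply/ffunP => i.
  by have := h i; rewrite !mxE => -[] /val_inj.
have := leq_card c cinj.
rewrite card_prod card_ffun !card_ord /W mulSn -[leqRHS]add0n leq_add2r leqn0.
by rewrite expn_eq0; case: (M) M0.
Qed.

End Covering.

(** * Counting the points of the box in a short arc *)

Section LocalDiscrepancy.
Variables (R : realType) (d : nat) (alpha : 'rV[R]_d).

Lemma count_predU_le (T : Type) (a b : pred T) (s : seq T) :
  (count (predU a b) s <= count a s + count b s)%N.
Proof. by rewrite -count_predUI leq_addr. Qed.

Lemma count_exists_le (T : Type) (I : finType) (a : I -> pred T) (s : seq T) :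
  (count (fun x => [exists i, a i x]) s <= \sum_i count (a i) s)%N.
Proof.
elim: s => [|x s IH] /=; first by [].
rewrite big_split/= leq_add//; case: existsP => // -[i ai].
by rewrite (bigD1 i)//= ai.
Qed.

Definition arc_count (N q : nat) (x : R) : nat :=
  count (fun n => fpart (linform alpha n - x) < q%:R^-1) (box d N).

(** The first summand counts points near the two endpoints of the arc, by packing over the whole
    box. The second counts the 2d boundary layers, of thickness (2Q+1) M, each cut into 2Q+1 cells
    in the thin direction and restricted to the arc. *)
Definition shift_error (Q N M q : nat) : nat :=
  (2 * (((N + N) %/ M).+1 ^ d * (Q * Q.*2.+1)) +
   d * (2 * (Q.*2.+1 * ((N + N) %/ M).+1 ^ d.-1 * (Q * M ^ d %/ q).+1)))%N.

(* Translation by k, where k.alpha approximates y - x modulo 1, maps the n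
   counted on the left to those counted on the right, except when n is close to
   the boundary of the box or n.alpha - x to an endpoint of the arc. *)
Lemma arc_count_shift Q N M q x y : well_spaced alpha Q -> (0 < Q)%N ->
  (0 < M <= N)%N -> (0 < q)%N ->
  (arc_count N q x <= arc_count N q y + shift_error Q N M q)%N.
Proof.
move=> ws Q0 /andP[M0 MN] q0; set K := Q.*2.+1; set L := ((N + N) %/ M)%N.
set l := (Q * M ^ d %/ q).+1.
have [k [m [hk hm]]] : reachable alpha M K (y - x) by exact: (covering _ ws).
have Md0 : 0 < (M ^ d)%:R :> R by rewrite ltr0n expn_gt0 M0.
have NL : (N + N < L.+1 * M)%N by exact: ltn_ceil.
(* [A] says that n + k is counted on the right. [B x] and [B z] hold just after the left and just
   before the right endpoint of the arc, within [D]; hence the choice of [z]. [S1 j] and [S2 j] say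
   that n + k leaves the box through a face in coordinate j. *)
pose P n := fpart (linform alpha n - x) < q%:R^-1.
pose A n := (n + k \in box d N) && (fpart (linform alpha (n + k) - y) < q%:R^-1).
pose B z n := fpart (linform alpha n - z) * (M ^ d)%:R < K%:R.
pose D : R := K%:R / (M ^ d)%:R; pose z := x + q%:R^-1 - D.
pose S1 j (n : 'rV[int]_d) := P n && (N%:Z < n ord0 j + k ord0 j).
pose S2 j (n : 'rV[int]_d) := P n && (n ord0 j + k ord0 j < - N%:Z).
have cover n : n \in box d N -> P n -> predU A (predU (predU (B x) (B z))
    (fun n => [exists j, predU (S1 j) (S2 j) n])) n.
  rewrite mem_box => /supnormP nN Pn; rewrite /predU/=.
  have [hj|/existsPn hS] := boolP [exists j, predU (S1 j) (S2 j) n].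
    by rewrite !orbT.
  have nkN : n + k \in box d N.
    rewrite mem_box; apply/supnormP => j; have := hS j; rewrite /= /S1 /S2 Pn !mxE.
    by move: (n ord0 j) (k ord0 j) => u v; clear; lia.
  have [Bx|Bx] := boolP (B x n); first by apply/orP; right; rewrite orTb.
  have [Bz|Bz] := boolP (B z n); first by rewrite !orbT.
  rewrite /A nkN/= !orbF; have [m' e] := fpartE (linform alpha n - x).
  move: hm; rewrite -ler_pdivlMr// -/D => hm.
  move: Pn Bx Bz; rewrite /P /B -!leNgt -!ler_pdivrMr// -/D e => Pn Bx Bz.
  have {Bz} Bz : linform alpha n - x - m'%:~R < q%:R^-1 - D.
    rewrite ltNge; apply/negP => h; have := le_trans Bz _.
    have h0 : 0 <= linform alpha n - z - m'%:~R by rewrite /z; lra.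
    by move=> /(_ _ (fpart_le h0)); rewrite /z; lra.
  move: hm; rewrite ler_norml => /andP[hm1 hm2].
  rewrite linformD; apply: le_lt_trans (fpart_le (m := m' + m) _) _; rewrite intrD; lra.
have bnd z' : (count (B z') (box d N) <= L.+1 ^ d * (Q * K))%N.
  rewrite -size_filter.
  have -> : (L.+1 ^ d = \prod_(j < d) ((fun _ : 'I_d => L) j).+1)%N.
    by rewrite prod_nat_const card_ord.
  apply: (packing (lo := fun=> - N%:Z) (x := z') ws M0); first by rewrite filter_uniq ?box_uniq.
    move=> n; rewrite mem_filter mem_box => /andP[_ /supnormP h] j; have := h j.
    by move: (n ord0 j) (L.+1 * M)%N NL => u v; clear; lia.
  move=> n; rewrite mem_filter => /andP[h _]; rewrite !natrM mulrCA ltr_pM2l ?ltr0n//.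
have bndS (S : 'I_d -> pred 'rV[int]_d) (lo0 : int) :
    (forall j n, n \in box d N -> S j n ->
      P n /\ lo0 <= n ord0 j < lo0 + (K * M)%N%:Z) ->
    forall j, (count (S j) (box d N) <= K * L.+1 ^ d.-1 * l)%N.
  move=> hS j; rewrite -size_filter.
  pose L' i := if i == j then Q.*2 else L.
  have -> : (K * L.+1 ^ d.-1 = \prod_(i < d) (L' i).+1)%N.
    rewrite (bigD1 j)//= /L' eqxx; congr muln.
    rewrite (eq_bigr (fun=> L.+1)) => [|i /negPf ->//].
    by rewrite prod_nat_const cardC1 card_ord.
  pose lo i := if i == j then lo0 else - N%:Z.
  apply: (packing (lo := lo) (x := x) ws M0); first by rewrite filter_uniq ?box_uniq.
    move=> n; rewrite mem_filter => /andP[Sn nN] i; rewrite /lo /L'.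
    have [_ h] := hS _ _ nN Sn.
    case: eqVneq => [->|_]; first exact: h.
    move: nN; rewrite mem_box => /supnormP/(_ i).
    by move: (n ord0 i) (L.+1 * M)%N NL => u v; clear; lia.
  move=> n; rewrite mem_filter => /andP[Sn nN]; have [Pn _] := hS _ _ nN Sn.
  have W0 : 0 < (Q * M ^ d)%:R :> R by rewrite ltr0n muln_gt0 Q0 expn_gt0 M0.
  have : fpart (linform alpha n - x) * (Q * M ^ d)%:R < q%:R^-1 * (Q * M ^ d)%:R.
    by rewrite ltr_pM2r.
  move=> h; apply: lt_trans h _; rewrite mulrC ltr_pdivrMr ?ltr0n//.
  by rewrite -natrM ltr_nat ltn_ceil.
have hS1 := bndS S1 (N%:Z - (K * M)%N%:Z + 1).
have hS2 := bndS S2 (- N%:Z).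
have kK j : (`|k ord0 j| <= K * M)%N by move/supnormP: hk.
have countA : (count A (box d N) <= arc_count N q y)%N.
  rewrite -size_filter /arc_count -size_filter -(size_map (fun n => n + k)).
  apply: uniq_leq_size.
    by rewrite map_inj_uniq ?filter_uniq ?box_uniq//; exact: addIr.
  by move=> n /mapP[u]; rewrite mem_filter => /andP[/andP[h1 h2] _] ->; rewrite mem_filter h2.
apply: leq_trans (_ : count (predU A (predU (predU (B x) (B z))
    (fun n => [exists j, predU (S1 j) (S2 j) n]))) (box d N) <= _)%N.
  rewrite /arc_count -!size_filter; apply: uniq_leq_size; first by rewrite filter_uniq ?box_uniq.
  by move=> n; rewrite !mem_filter => /andP[Pn nN]; rewrite nN andbT cover.
apply: leq_trans (count_predU_le _ _ _) _; apply: leq_add => //.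
apply: leq_trans (count_predU_le _ _ _) _; apply: leq_add.
  by apply: leq_trans (count_predU_le _ _ _) _; rewrite mul2n -addnn leq_add.
apply: leq_trans (count_exists_le _ _) _.
rewrite -[d in (d * _)%N]card_ord -sum_nat_const; apply: leq_sum => j _.
apply: leq_trans (count_predU_le _ _ _) _; rewrite mul2n -addnn; apply: leq_add.
  apply: hS1 => i n; rewrite mem_box /S1 => /supnormP/(_ i) h1 /andP[-> h2]; split => //.
  by move: (kK i) h1 h2; move: (n ord0 i) (k ord0 i) (K * M)%N => u v w; clear; lia.
apply: hS2 => i n; rewrite mem_box /S2 => /supnormP/(_ i) h1 /andP[-> h2]; split => //.
by move: (kK i) h1 h2; move: (n ord0 i) (k ord0 i) (K * M)%N => u v w; clear; lia.
Qed.

(** With L cells per side and l cells along the arc, L M <= 3 N since M <= N, and l M <= (Q+1) N by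
    the bound on M^(d+1). Thus the boundary layers, like the endpoints, contribute O((N/M)^d). *)
Lemma shift_error_le Q N M q : (0 < d)%N -> (0 < M <= N)%N -> (0 < q)%N ->
  (M ^ d.+1 <= N * q)%N ->
  (shift_error Q N M q * M ^ d <=
    (2 * 3 ^ d * Q * Q.*2.+1 + 2 * d * Q.*2.+1 * 3 ^ d * Q.+1) * N ^ d)%N.
Proof.
move=> d0 /andP[M0 MN] q0 hM; rewrite /shift_error.
set L := (_ %/ M).+1; set K := Q.*2.+1; set l := (_ %/ q).+1.
have hL : (L * M <= 3 * N)%N.
  by rewrite /L mulSn; have := leq_trunc_div (N + N) M; lia.
have hl : (l * M <= Q.+1 * N)%N.
  rewrite /l !mulSn leq_add//.
  rewrite -(leq_pmul2r q0) mulnAC.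
  apply: leq_trans (leq_mul (leq_trunc_div _ _) (leqnn M)) _.
  by rewrite -!mulnA -expnSr leq_mul2l hM orbT.
clearbody K L l; rewrite mulnDl [leqRHS]mulnDl; apply: leq_add.
  have : ((L * M) ^ d <= (3 * N) ^ d)%N by rewrite leq_exp2r.
  rewrite !expnMn => h.
  have h' := leq_mul (leqnn (2 * Q * K)%N) h.
  apply: leq_trans (leq_trans (eq_leq _) h') (eq_leq _); ring.
case: (d) d0 => // d' _; rewrite succnK.
have h : ((L * M) ^ d' <= (3 * N) ^ d')%N by case: (d') => // d''; rewrite leq_exp2r.
have := leq_mul (leq_mul h hl) (leqnn (2 * d'.+1 * K)%N).
rewrite !expnMn !expnS => h'.
apply: leq_trans (_ : (2 * d'.+1 * K * 3 ^ d' * Q.+1) * (N * N ^ d') <= _)%N.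
  move: h'; move: (L ^ d')%N (M ^ d')%N (3 ^ d')%N (N ^ d')%N => a b c e h'.
  apply: leq_trans (leq_trans (eq_leq _) h') (eq_leq _); ring.
rewrite leq_mul2r; apply/orP; right; move: (3 ^ d')%N => c; nia.
Qed.

Lemma sum_arc_count N q : (0 < q)%N ->
  (\sum_(i < q) arc_count N q (i%:R / q%:R) = (N + N).+1 ^ d)%N.
Proof.
move=> q0; rewrite -size_box /arc_count.
under eq_bigr do rewrite -sum1_count big_mkcond/=.
rewrite exchange_big/= -sum1_size; apply: eq_bigr => n _.
rewrite -[RHS](fpart_interval (linform alpha n) q0); apply: eq_bigr => i _.
by case: ifP.
Qed.

(** The q arc counts have mean (2N+1)^d / q and differ pairwise by at most the shift error, so each
    is that close to the mean. *)
Lemma arc_count_approx Q : (0 < d)%N -> well_spaced alpha Q -> (0 < Q)%N ->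
  exists C : nat, forall N M q : nat, (0 < M <= N)%N -> (0 < q)%N ->
    (M ^ d.+1 <= N * q)%N ->
    `|(arc_count N q 0)%:R - (N + N).+1%:R ^+ d / q%:R| <= C%:R * (N%:R / M%:R) ^+ d :> R.
Proof.
move=> d0 ws Q0.
exists (2 * 3 ^ d * Q * Q.*2.+1 + 2 * d * Q.*2.+1 * 3 ^ d * Q.+1)%N => N M q MN q0 hM.
have := shift_error_le Q d0 MN q0 hM.
set C := (_ + _)%N => hE; have /andP[M0 _] := MN.
apply: (@le_trans _ _ (shift_error Q N M q)%:R).
  have qR : 0 < q%:R :> R by rewrite ltr0n.
  rewrite -(ler_pM2r qR) -[X in _ * X <= _]gtr0_norm// -normrM mulrBl divfK ?gt_eqF//.
  rewrite -natrX -(sum_arc_count N q0) natr_sum.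
  have -> : (arc_count N q 0)%:R * q%:R = \sum_(i < q) (arc_count N q 0)%:R :> R.
    by rewrite sumr_const card_ord mulr_natr.
  have -> : (shift_error Q N M q)%:R * q%:R = \sum_(i < q) (shift_error Q N M q)%:R :> R.
    by rewrite sumr_const card_ord mulr_natr.
  rewrite -sumrB; apply: le_trans (ler_norm_sum _ _ _) _; apply: ler_sum => i _.
  have h1 := arc_count_shift 0 (i%:R / q%:R) ws Q0 MN q0.
  have h2 := arc_count_shift (i%:R / q%:R) 0 ws Q0 MN q0.
  by rewrite ler_distl lerBlDr -!natrD !ler_nat h1 h2.
rewrite expr_div_n mulrA ler_pdivlMr ?exprn_gt0 ?ltr0n//.
by rewrite -!natrX -!natrM ler_nat.
Qed.

End LocalDiscrepancy.

(** * Harmonic sums, sums of roots and the layer-cake formula *)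

Section Sums.
Variable R : realType.

(** This is ln (1 + t) <= t at t = 1/n and at t = -1/(n+1). *)
Lemma lnS_bounds (n : nat) : (0 < n)%N ->
  n.+1%:R^-1 <= ln (n.+1%:R : R) - ln (n%:R : R) <= n%:R^-1.
Proof.
move=> n0; have n0R : 0 < n%:R :> R by rewrite ltr0n.
have nS0R : 0 < n.+1%:R :> R by [].
have nV : 0 < n%:R^-1 :> R by rewrite invr_gt0.
have nSV : 0 < n.+1%:R^-1 :> R by rewrite invr_gt0.
rewrite -ln_div ?posrE//; apply/andP; split; last first.
  have -> : n.+1%:R / n%:R = 1 + n%:R^-1 :> R.
    by rewrite -natr1 mulrDl mul1r divff ?gt_eqF// addrC.
  by apply: le_ln1Dx; lra.
rewrite -[_ / _]invrK lnV ?posrE ?invr_gt0 ?divr_gt0// lerNr invf_div.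
have -> : n%:R / n.+1%:R = 1 + (- n.+1%:R^-1) :> R.
  by rewrite -[n%:R](addrK 1) natr1 mulrBl mul1r divff ?gt_eqF.
apply: le_ln1Dx; rewrite ltrN2 invf_lt1// ltr1n.
by rewrite ltnS.
Qed.

(** Telescoping of [lnS_bounds] from X = 1 on; at X = 0 the convention ln 0 = 0 makes the upper
    bound true. *)
Lemma harmonic_bounds (X : nat) :
  ln (X.+1%:R : R) <= \sum_(1 <= q < X.+1) q%:R^-1 <= 1 + ln (X%:R : R).
Proof.
elim: X => [|[|X] IH].
- by rewrite big_geq// ln1 ln0// addr0 lexx ler01.
- rewrite big_nat1 ln1 addr0 invr1 lexx andbT.
  by have := @lnS_bounds 1 isT; rewrite ln1 subr0 invr1 => /andP[_ ->].
- rewrite big_nat_recr//=; have := @lnS_bounds X.+1 isT; have := @lnS_bounds X.+2 isT.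
  move: IH; move: (ln X.+3%:R) (ln X.+2%:R) (ln X.+1%:R) => a b c.
  move: X.+3%:R^-1 X.+2%:R^-1 X.+1%:R^-1 => i j k.
  by move: (\sum_(_ <= _ < _) _) => s; lra.
Qed.

(* Telescoping: with y^k = X + 1 and x^k = X, the identity
   1 = y^k - x^k <= k (y - x) y^(k-1) gives y / y^k <= k (y - x). *)
Lemma sum_root_div_le (k : nat) (r : nat -> R) (X : nat) :
  (forall q, 0 <= r q) -> (forall q, r q ^+ k.+1 = q%:R) ->
  \sum_(1 <= q < X.+1) r q / q%:R <= k.+1%:R * r X.
Proof.
move=> r0 rE; elim: X => [|X IH]; first by rewrite big_geq// mulr_ge0.
rewrite big_nat_recr//= -lerBrDr; apply: le_trans IH _.
rewrite lerBrDr -lerBrDl -mulrBr.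
have rS : 0 < r X.+1.
  by rewrite lt_def r0 andbT; apply: contraTneq (ltr0Sn R X) => e; rewrite -rE e expr0n ltxx.
have rle : r X <= r X.+1.
  by rewrite -(@ler_pXn2r _ k.+1) ?nnegrE ?r0// !rE ler_nat.
have : r X.+1 ^+ k.+1 - r X ^+ k.+1 <= (r X.+1 - r X) * (k.+1%:R * r X.+1 ^+ k).
  rewrite subrXX; apply: ler_wpM2l; first by rewrite subr_ge0.
  rewrite mulr_natl -[X in _ *+ X]card_ord -sumr_const; apply: ler_sum => i _.
  have ik : (i <= k)%N by rewrite -ltnS.
  apply: (@le_trans _ _ (r X.+1 ^+ (k - i) * r X.+1 ^+ i)); last by rewrite -exprD subnK.
  by rewrite ler_wpM2l ?exprn_ge0// lerXn2r ?nnegrE// r0.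
have e : X.+1%:R - X%:R = 1 :> R by rewrite -natr1 addrAC subrr add0r.
rewrite !rE e => h; rewrite -(rE X.+1) exprS invfM mulrA divff ?gt_eqF// mul1r.
rewrite -[_^-1]mul1r ler_pdivrMr ?exprn_gt0//.
by rewrite mulrAC mulrC.
Qed.

(** Only the integers 1 <= q < v are counted, and the cutoff X loses none of them. The induction on
    X also has to carry the case X < v, where every q counts. *)
Lemma layer_cake (v : R) (X : nat) : 0 <= v <= X%:R ->
  `|(\sum_(1 <= q < X.+1) (q%:R < v)%R)%N%:R - v| <= 1.
Proof.
move=> /andP[v0 vX].
suff [_ h] : (X%:R < v -> (\sum_(1 <= q < X.+1) (q%:R < v)%R)%N = X) /\
    (v <= X%:R -> v - 1 <= (\sum_(1 <= q < X.+1) (q%:R < v)%R)%N%:R <= v).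
  by rewrite ler_distl; have := h vX; lra.
elim: X {vX} => [|X [IH1 IH2]].
  by rewrite big_geq//; split => // h; lra.
rewrite big_nat_recr//=; split => h.
  by rewrite h addn1 IH1// (lt_trans _ h)// ltr_nat.
rewrite ltNge h/= addn0; have [hX|hX] := leP v X%:R; first exact: IH2.
by rewrite IH1//; rewrite -natr1 in h; lra.
Qed.

End Sums.

(** * The first sum *)

Section FirstSum.
Variables (R : realType) (d : nat) (alpha : 'rV[R]_d) (Q : nat).
Hypotheses (d0 : (0 < d)%N) (ws : well_spaced alpha Q) (Q0 : (0 < Q)%N).

Let root (q : nat) : R := q%:R `^ d.+1%:R^-1.

Let root_ge0 q : 0 <= root q. Proof. exact: powR_ge0. Qed.

Let rootX q : root q ^+ d.+1 = q%:R.
Proof. by rewrite /root -powR_mulrn ?powR_ge0// -powRrM mulVf ?powRr1. Qed.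

Let root_ge1 q : (0 < q)%N -> 1 <= root q.
Proof.
by move=> q0; rewrite -(@ler_pXn2r _ d.+1) ?nnegrE// expr1n rootX ler1n.
Qed.

Lemma box_card_le (N : nat) : (0 < N)%N ->
  (N + N).+1%:R ^+ d <= 3 ^+ d * N%:R ^+ d :> R.
Proof.
move=> N0; rewrite -exprMn lerXn2r ?nnegrE ?mulr_ge0//.
by rewrite -natrM ler_nat; lia.
Qed.

(** Taking M near (N q)^(1/(d+1)), the largest size that [arc_count_approx] allows, gives at q an
    error of order N^(d-1) (N q)^(1/(d+1)) / q. By [sum_root_div_le], summing over q <= N^d leaves
    N^(d-1) (N N^d)^(1/(d+1)) = N^d. *)
Lemma sum_arc_count_approx : exists C : nat, forall N : nat, (0 < N)%N ->
  \sum_(1 <= q < (N ^ d).+1)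
    `|(arc_count alpha N q 0)%:R - (N + N).+1%:R ^+ d / q%:R| <= C%:R * N%:R ^+ d :> R.
Proof.
have [C hC] := arc_count_approx d0 ws Q0.
exists (C * 2 ^ d * d.+1)%N => N N0.
have NR : 0 < N%:R :> R by rewrite ltr0n.
apply: (@le_trans _ _ (\sum_(1 <= q < (N ^ d).+1)
    C%:R * 2 ^+ d * (N%:R ^+ d / N%:R) * root N * (root q / q%:R))).
  rewrite !big_nat; apply: ler_sum => q /andP[q0]; rewrite ltnS => qN.
  have qR : 0 < q%:R :> R by rewrite ltr0n.
  pose t := root N * root q.
  have tX : t ^+ d.+1 = N%:R * q%:R by rewrite exprMn !rootX.
  have t1 : 1 <= t by rewrite -[1]mulr1 ler_pM// root_ge1.
  have t0 : 0 < t by lra.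
  have /andP[M1 M2] := truncn_itv (ltW t0); set M := Num.truncn t in M1 M2.
  have M0 : (0 < M)%N by rewrite truncn_gt0.
  have MR : 0 < M%:R :> R by rewrite ltr0n.
  have MX : (M ^ d.+1 <= N * q)%N.
    by rewrite -(ler_nat R) natrX natrM -tX lerXn2r ?nnegrE// ltW.
  have MN : (M <= N)%N.
    rewrite -(@leq_exp2r _ _ d.+1)// (leq_trans MX)// expnS leq_mul2l qN orbT//.
  apply: le_trans (hC N M q _ q0 MX) _; first by rewrite M0.
  rewrite -!mulrA ler_wpM2l//.
  (* Rounding t down loses at most a factor 2 because M >= 1; this is the source of 2^d in the
     constant. *)
  have tM : t <= 2 * M%:R.
    have : (1 : R) <= M%:R by rewrite ler1n.
    by rewrite -natr1 in M2; lra.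
  apply: (@le_trans _ _ ((2 * N%:R / t) ^+ d)).
    rewrite lerXn2r ?nnegrE ?divr_ge0 ?mulr_ge0// ?(ltW t0)//.
    rewrite ler_pdivrMr// mulrAC ler_pdivlMr// mulrC [leRHS]mulrAC.
    by rewrite ler_wpM2r.
  rewrite expr_div_n exprMn -!mulrA ler_wpM2l// le_eqVlt; apply/orP; left; apply/eqP.
  have -> : t ^- d = t / (N%:R * q%:R).
    by rewrite -tX exprS invfM mulrA divff ?gt_eqF// mul1r.
  by rewrite /t invfM; ring.
rewrite -mulr_sumr; apply: (@le_trans _ _
    (C%:R * 2 ^+ d * (N%:R ^+ d / N%:R) * root N * (d.+1%:R * root (N ^ d)))).
  apply: ler_wpM2l; last exact: sum_root_div_le.
  by rewrite !mulr_ge0// ?exprn_ge0// invr_ge0.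
have rN : root N * root (N ^ d) = N%:R.
  apply/eqP; rewrite -(@eqrXn2 _ d.+1)// ?mulr_ge0//.
  by rewrite exprMn !rootX natrX -exprS.
rewrite (_ : _ * _ =
    C%:R * 2 ^+ d * d.+1%:R * (N%:R ^+ d / N%:R) * (root N * root (N ^ d))); last by ring.
by rewrite rN !natrM natrX -!mulrA mulVf ?gt_eqF// mulr1.
Qed.

Lemma linform_fpart_ge N n : n != 0 -> n \in box d N ->
  1 <= (Q * N ^ d)%:R * fpart (linform alpha n).
Proof.
rewrite mem_box => n0 nN; have := ws n0 nN (Num.floor (linform alpha n)).
by rewrite [`|_|]ger0_norm ?subr_ge0 ?floor_le.
Qed.

Lemma linform_fpart_neq0 n : n != 0 -> fpart (linform alpha n) != 0.
Proof.
move=> n0; have nN : n \in box d (supnorm n) by rewrite mem_box.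
by apply: contraTneq (linform_fpart_ge n0 nN) => ->; rewrite mulr0 ler10.
Qed.

(** The 1 subtracted is the contribution of the vector 0, which lies in every arc starting at 0. *)
Lemma arc_countE N q : (0 < q)%N -> (arc_count alpha N q 0)%:R - 1 =
  \sum_(n <- box d N | n != 0) (q%:R < (fpart (linform alpha n))^-1)%R%:R :> R.
Proof.
move=> q0; have qR : 0 < q%:R :> R by rewrite ltr0n.
have b0 : 0 \in box d N by rewrite mem_box; apply/supnormP => j; rewrite mxE.
rewrite /arc_count -sum1_count big_mkcond/= (bigD1_seq 0)/= ?box_uniq//.
rewrite linform0 subr0 fpart_small ?lexx ?ltr01// invr_gt0 qR natrD addrAC subrr add0r.
rewrite natr_sum; apply: eq_bigr => n n0; rewrite subr0.
have u0 : 0 < fpart (linform alpha n) by rewrite lt_def fpart_ge0 linform_fpart_neq0.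
by rewrite -[fpart _ in LHS]invrK ltf_pV2 ?posrE ?invr_gt0//; case: ifP.
Qed.

(** Apply [layer_cake] to v = 1/{n.alpha}, for which the cutoff Q N^d is admissible by well-spacing;
    each point of the box costs at most 1. *)
Lemma sum_fpart_inv_layers N : (0 < N)%N ->
  `|\sum_(n <- box d N | n != 0) (fpart (linform alpha n))^-1
    - \sum_(1 <= q < (Q * N ^ d).+1) ((arc_count alpha N q 0)%:R - 1)|
  <= (N + N).+1%:R ^+ d :> R.
Proof.
move=> N0; rewrite -natrX -size_box -sum1_size natr_sum big_mkcond/=.
rewrite [X in _ - X](_ : _ = \sum_(n <- box d N | n != 0)
    (\sum_(1 <= q < (Q * N ^ d).+1) (q%:R < (fpart (linform alpha n))^-1)%R)%N%:R); last first.
  under [RHS]eq_bigr do rewrite natr_sum.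
  rewrite exchange_big/= !big_nat; apply: eq_bigr => q /andP[q0 _].
  exact: arc_countE.
rewrite [X in _ - X]big_mkcond/= -sumrB big_seq [leRHS]big_seq.
apply: le_trans (ler_norm_sum _ _ _) _; apply: ler_sum => n nN.
case: ifPn => [n0|_]; last by rewrite subr0 normr0 ler01.
rewrite distrC; apply: layer_cake; rewrite invr_ge0 fpart_ge0/=.
have u0 : 0 < fpart (linform alpha n) by rewrite lt_def fpart_ge0 linform_fpart_neq0.
by rewrite -[_^-1]mul1r ler_pdivrMr// linform_fpart_ge.
Qed.

Lemma arc_count_anti N q q' : (0 < q <= q')%N ->
  (arc_count alpha N q' 0 <= arc_count alpha N q 0)%N.
Proof.
move=> /andP[q0 qq']; apply: sub_count => n /= h; apply: lt_le_trans h _.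
by rewrite lef_pV2 ?posrE ?ltr0n ?ler_nat// (leq_trans q0).
Qed.

(** The factor N expresses a saving over N^d without the exponent d - 1. As ln N <= N, it allows
    (2N+1)^d to be replaced by (2N)^d in the main term at a cost of O(N^d). *)
Lemma box_card_sub_le (N : nat) : (0 < N)%N ->
  0 <= ((N + N).+1%:R ^+ d - (2 * N%:R : R) ^+ d) * N%:R <= d%:R * 3 ^+ d * N%:R ^+ d.
Proof.
move=> N0; have NR : 0 < N%:R :> R by rewrite ltr0n.
have e : (N + N).+1%:R = 2 * N%:R + 1 :> R by rewrite -natr1 natrD; ring.
have h3 : 2 * N%:R + 1 <= 3 * N%:R :> R.
  have : (1 : R) <= N%:R by rewrite ler1n.
  lra.
have b0 : 0 <= 2 * N%:R :> R by rewrite mulr_ge0.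
have NT : N%:R <= 3 * N%:R :> R by lra.
rewrite e; move: (2 * _) (3 * N%:R) b0 h3 NT (exprMn d 3 (N%:R : R)) => b t b0 bt Nt te.
have b10 : 0 <= b + 1 by lra.
apply/andP; split.
  by rewrite mulr_ge0// subr_ge0 lerXn2r ?nnegrE//; lra.
rewrite subrXX addrAC subrr add0r mul1r mulr_suml.
have -> : d%:R * 3 ^+ d * N%:R ^+ d = \sum_(i < d) t ^+ d.
  by rewrite sumr_const card_ord te -mulrA mulr_natl.
apply: ler_sum => i _; rewrite -[X in _ <= t ^+ X]prednK// exprSr.
have id1 : (i <= d.-1)%N by rewrite -ltnS prednK.
apply: ler_pM => //; first by rewrite mulr_ge0// exprn_ge0.
apply: (@le_trans _ _ (t ^+ (d.-1 - i) * t ^+ i)); last by rewrite -exprD subnK.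
by apply: ler_pM; rewrite ?exprn_ge0// lerXn2r ?nnegrE//; lra.
Qed.

Lemma sum_fpart_inv : exists C : R, forall N : nat, (0 < N)%N ->
  `|\sum_(n <- box d N | n != 0) (fpart (linform alpha n))^-1
    - d%:R * 2 ^+ d * N%:R ^+ d * ln N%:R| <= C * N%:R ^+ d.
Proof.
have [C hC] := sum_arc_count_approx; have [C' hC'] := arc_count_approx d0 ws Q0.
(* The three groups come from the layer-cake error, the range N^d < q <= Q N^d, and the range q <=
   N^d compared with the main term. *)
exists (3 ^+ d + Q%:R * (3 ^+ d + C'%:R) + (C%:R + 1 + 3 ^+ d + d%:R * d%:R * 3 ^+ d)) => N N0.
have NR : 0 < N%:R :> R by rewrite ltr0n.
have N1 : 1 <= N%:R :> R by rewrite ler1n.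
have Nd0 : (0 < N ^ d)%N by rewrite expn_gt0 N0.
have NdR : 0 < N%:R ^+ d :> R by rewrite exprn_gt0.
pose P : R := (N + N).+1%:R ^+ d; have P3 : P <= 3 ^+ d * N%:R ^+ d by exact: box_card_le.
pose H : R := \sum_(1 <= q < (N ^ d).+1) q%:R^-1.
pose c q : R := (arc_count alpha N q 0)%:R.
(* At q = N^d the choice M = N is admissible, so this count is bounded independently of N; by
   monotonicity so are the counts in the tail, of which there are at most Q N^d. *)
have c_last : c (N ^ d)%N <= 3 ^+ d + C'%:R.
  have := hC' N N (N ^ d)%N; rewrite N0 leqnn -expnS leqnn => /(_ isT Nd0 isT).
  rewrite divff ?gt_eqF// expr1n mulr1 ler_distl => /andP[_ /le_trans]; apply.
  by rewrite lerD2r natrX ler_pdivrMr.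
have c_ge1 q : (0 < q)%N -> 0 <= c q - 1.
  by move=> q0; rewrite arc_countE// sumr_ge0.
have tail : `|\sum_((N ^ d).+1 <= q < (Q * N ^ d).+1) (c q - 1)| <=
    Q%:R * (3 ^+ d + C'%:R) * N%:R ^+ d.
  rewrite big_nat; apply: le_trans (ler_norm_sum _ _ _) _.
  apply: (@le_trans _ _ (\sum_((N ^ d).+1 <= q < (Q * N ^ d).+1) (3 ^+ d + C'%:R))).
    rewrite [leRHS]big_nat; apply: ler_sum => q /andP[q1 _].
    have q0 : (0 < q)%N by exact: leq_trans q1.
    rewrite ger0_norm ?c_ge1//; apply: le_trans c_last.
    rewrite lerBlDr; apply: ler_wpDr => //.
    by rewrite ler_nat arc_count_anti// Nd0 ltnW.
  rewrite sumr_const_nat -[leLHS]mulr_natl [leRHS]mulrAC ler_wpM2r ?addr_ge0 ?exprn_ge0//.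
  by rewrite -natrX -natrM ler_nat subSS leq_subr.
have Hln : `|H - d%:R * ln N%:R| <= 1.
  have -> : d%:R * ln N%:R = ln (N ^ d)%:R :> R by rewrite natrX lnXn// mulr_natl.
  have /andP[H1 H2] := harmonic_bounds R (N ^ d).
  have : ln (N ^ d)%:R <= ln (N ^ d).+1%:R :> R by rewrite ler_ln ?posrE ?ltr0n// ler_nat.
  by rewrite ler_distl -/H in H1 H2 *; lra.
have head : `|\sum_(1 <= q < (N ^ d).+1) (c q - 1) - P * H| <= (C%:R + 1) * N%:R ^+ d.
  have -> : \sum_(1 <= q < (N ^ d).+1) (c q - 1) - P * H =
      \sum_(1 <= q < (N ^ d).+1) (c q - P / q%:R) - N%:R ^+ d.
    rewrite !sumrB sumr_const_nat subSS subn0 -mulr_sumr -natrX addrAC; congr (_ - _ - _).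
  rewrite mulrDl mul1r; apply: le_trans (ler_normB _ _) _.
  rewrite [`|_ ^+ _|]gtr0_norm// lerD2r; apply: le_trans (hC N N0).
  exact: ler_norm_sum.
have lnN : 0 <= ln (N%:R : R) <= N%:R by rewrite ln_ge0//= ltW// ln_sublinear.
have /andP[D0 D1] := box_card_sub_le N0; rewrite -/P in D0 D1.
(* Two replacements: [H] by d ln N, and (2N+1)^d by (2N)^d. *)
have main : `|P * H - d%:R * 2 ^+ d * N%:R ^+ d * ln N%:R| <=
    (3 ^+ d + d%:R * d%:R * 3 ^+ d) * N%:R ^+ d.
  have -> : P * H - d%:R * 2 ^+ d * N%:R ^+ d * ln N%:R =
     P * (H - d%:R * ln N%:R) + d%:R * ((P - (2 * N%:R) ^+ d) * ln N%:R).
    by rewrite exprMn; ring.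
  rewrite [leRHS]mulrDl; apply: le_trans (ler_normD _ _) _; apply: lerD.
    rewrite normrM ger0_norm ?exprn_ge0//; apply: le_trans P3.
    by rewrite ler_piMr// exprn_ge0.
  have PB : 0 <= P - (2 * N%:R) ^+ d by rewrite -(pmulr_lge0 _ NR).
  have /andP[l0 l1] := lnN.
  rewrite ger0_norm ?mulr_ge0// -!mulrA ler_wpM2l// !mulrA; apply: le_trans D1.
  by rewrite ler_wpM2l.
have h1 := sum_fpart_inv_layers N0; rewrite -/P in h1.
rewrite (@big_cat_nat _ _ _ (N ^ d).+1)//= in h1; last by rewrite ltnS leq_pmull.
move: tail head main h1 P3; rewrite !mulrDl.
move: (\sum_(_ <- _ | _) _) (\sum_(1 <= _ < _) _) (\sum_((N ^ d).+1 <= _ < _) _) => S U V.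
rewrite !ler_norml => /andP[? ?] /andP[? ?] /andP[? ?] /andP[? ?] ?.
by apply/andP; split; lra.
Qed.

Lemma sum_dist_int_inv : exists C : R, forall N : nat, (0 < N)%N ->
  `|\sum_(n <- box d N | n != 0) (dist_int (linform alpha n))^-1
    - d%:R * 2 ^+ d.+1 * N%:R ^+ d * ln N%:R| <= C * N%:R ^+ d.
Proof.
have [C hC] := sum_fpart_inv; exists (2 * 3 ^+ d + 2 * C) => N N0.
have sym : \sum_(n <- box d N | n != 0) (fpart (- linform alpha n))^-1 =
    \sum_(n <- box d N | n != 0) (fpart (linform alpha n))^-1.
  rewrite -[RHS](perm_big _ (perm_boxN d N)) [RHS]big_map.
  by apply: eq_big => n; [rewrite oppr_eq0 | rewrite linformN].
have h : `|\sum_(n <- box d N | n != 0) (dist_int (linform alpha n))^-1 -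
    2 * \sum_(n <- box d N | n != 0) (fpart (linform alpha n))^-1| <= 2 * 3 ^+ d * N%:R ^+ d.
  rewrite mulr_natl mulr2n -{2}sym -big_split/= -sumrB.
  apply: le_trans (ler_norm_sum _ _ _) _.
  apply: (@le_trans _ _ (\sum_(n <- box d N) 2)).
    rewrite big_mkcond/=; apply: ler_sum => n _; case: ifPn => // n0.
    by apply: dist_int_inv; exact: linform_fpart_neq0.
  rewrite big_const_seq count_predT iter_addr_0 size_box -[leLHS]mulr_natr natrX -mulrA ler_wpM2l//.
  exact: box_card_le.
move: h (hC N N0); rewrite exprS !mulrDl.
move: (\sum_(_ <- _ | _) _) (\sum_(_ <- _ | _) _) => S T.
rewrite !ler_norml => /andP[? ?] /andP[? ?].
by apply/andP; split; lra.
Qed.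

End FirstSum.

(** * Partial summation, from N^d log N to (log N)^2 *)

Section PartialSummation.
Variable R : realType.

(** Meant for x = 1/(N+1), where 1 - x = N/(N+1). *)
Lemma exprB1_bounds (x : R) (d : nat) : 0 <= x <= 1 ->
  1 - d%:R * x <= (1 - x) ^+ d <= 1 - d%:R * x + d%:R ^+ 2 * x ^+ 2.
Proof.
move=> /andP[x0 x1]; elim: d => [|d /andP[IH1 IH2]].
  by rewrite expr0 expr0n/= !mul0r subr0 addr0 lexx.
rewrite exprS -natr1; have d0 : 0 <= d%:R :> R by [].
have y0 : 0 <= 1 - x by lra.
have h1 := ler_wpM2l y0 IH1; have h2 := ler_wpM2l y0 IH2.
move: (d%:R) d0 h1 h2 => e e0 h1 h2.
have ex2 : 0 <= e * x ^+ 2 by rewrite mulr_ge0// exprn_ge0.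
have ex3 : 0 <= e ^+ 2 * x ^+ 3 by rewrite mulr_ge0// exprn_ge0.
have x2 : 0 <= x ^+ 2 by rewrite exprn_ge0.
apply/andP; split; first by apply: le_trans h1; nra.
by apply: le_trans h2 _; nra.
Qed.

Variables (d : nat) (a C : R) (A S : nat -> R).
Hypothesis a0 : 0 <= a.
Hypothesis hA : forall N, (0 < N)%N ->
  `|A N - a * N%:R ^+ d * ln N%:R| <= C * N%:R ^+ d.
Hypothesis hS : forall N, (0 < N)%N ->
  S N.+1 - S N = (A N.+1 - A N) / N.+1%:R ^+ d.

(** Abel summation: the increment of [T] is A N (N^-d - (N+1)^-d), while the part removed from [S]
    is only O(log N). *)
Let T N := S N - A N / N%:R ^+ d.

(** The increment of [T] is about a d ln N / N and that of (ln N)^2 about 2 ln N / N; [b] is the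
    ratio. *)
Let b := a * d%:R / 2.

Let C_ge0 : 0 <= C.
Proof. by have := hA (ltn0Sn 0); rewrite expr1n !mulr1; apply: le_trans. Qed.

Let C3 := a * (d%:R ^+ 2 + d%:R) + C * d%:R + b.

(** Beyond the matching first-order terms, the worst contribution is of order ln N / N^2, which is
    at most 1/N because ln N <= N. *)
Let T_step N : (0 < N)%N ->
  `|T N.+1 - T N - b * (ln N.+1%:R ^+ 2 - ln N%:R ^+ 2)| <= C3 / N%:R.
Proof.
move=> N0; have NR : 0 < N%:R :> R by rewrite ltr0n.
have NS : 0 < N.+1%:R :> R by [].
pose x : R := N.+1%:R^-1; pose y : R := N%:R^-1.
have x0 : 0 < x by rewrite invr_gt0.
have y1 : y <= 1 by rewrite invf_le1// ler1n.
have xy : x <= y by rewrite lef_pV2 ?posrE// ler_nat.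
have yx : y - x = x * y.
  rewrite /x /y -natr1; field; rewrite gt_eqF//= natr1 pnatr_eq0//.
pose L : R := ln N%:R; pose D := ln N.+1%:R - L.
have /andP[D1 D2] : x <= D <= y by exact: lnS_bounds.
have L0 : 0 <= L by rewrite ln_ge0// ler1n.
have Ly : L * y <= 1.
  by rewrite ler_pdivrMr// mul1r ltW// ln_sublinear.
pose w := 1 - (1 - x) ^+ d.
have /andP[w1 w2] := @exprB1_bounds x d (introT andP (conj (ltW x0) (le_trans xy y1))).
have Nx : N%:R * x = 1 - x.
  by rewrite -[N%:R](addrK 1) natr1 mulrBl mul1r divff ?gt_eqF.
have Nw : w = N%:R ^+ d * (N%:R ^- d - N.+1%:R ^- d).
  by rewrite mulrBr divff ?gt_eqF ?exprn_gt0// -exprVn -exprMn Nx.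
pose e := A N / N%:R ^+ d - a * L.
have Nd : 0 < N%:R ^+ d :> R by rewrite exprn_gt0.
have he : `|e| <= C.
  have -> : e = (A N - a * N%:R ^+ d * L) / N%:R ^+ d.
    by rewrite /e; field; rewrite gt_eqF.
  by rewrite normrM normfV [X in _ / X]gtr0_norm// ler_pdivrMr// hA.
have TE : T N.+1 - T N = (a * L + e) * w.
  have -> : a * L + e = A N / N%:R ^+ d by rewrite /e; ring.
  have -> : T N.+1 - T N = A N * (N%:R ^- d - N.+1%:R ^- d).
    have := hS N0; rewrite /T mulrBl => E.
    by rewrite (_ : _ - _ - _ = S N.+1 - S N - A N.+1 / N.+1%:R ^+ d + A N / N%:R ^+ d);
      [rewrite E; ring | ring].
  by rewrite Nw mulrA divfK ?gt_eqF.
have LE : ln N.+1%:R = L + D :> R by rewrite /D; ring.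
rewrite TE LE.
(* Since 2 b = a d, the terms a d L D cancel; the three that remain give the three summands of
   [C3]. *)
have -> : (a * L + e) * w - b * ((L + D) ^+ 2 - ln N%:R ^+ 2) =
    a * L * (w - d%:R * D) + e * w - b * D ^+ 2.
  by rewrite -/L /b; field.
have b0 : 0 <= b by rewrite /b divr_ge0// mulr_ge0.
have y0 : 0 < y by exact: lt_le_trans xy.
have xx : x ^+ 2 <= x * y by rewrite expr2 ler_wpM2l// ltW.
have xyy : x * y <= y * y by rewrite ler_wpM2r// ltW.
have d0 : 0 <= d%:R :> R by [].
have wd : `|w - d%:R * D| <= (d%:R ^+ 2 + d%:R) * (y * y).
  have h1 : d%:R * x <= d%:R * D by rewrite ler_wpM2l.
  have h2 : d%:R * D <= d%:R * (x + y * y) by rewrite ler_wpM2l//; lra.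
  have h3 : d%:R ^+ 2 * x ^+ 2 <= d%:R ^+ 2 * (y * y).
    by rewrite ler_wpM2l ?exprn_ge0//; lra.
  have h4 : 0 <= d%:R ^+ 2 * (y * y) by rewrite mulr_ge0 ?exprn_ge0 ?mulr_ge0// ltW.
  have h5 : 0 <= d%:R * (y * y) by rewrite !mulr_ge0// ltW.
  by rewrite mulrDl ler_norml /w; lra.
have t1 : `|a * L * (w - d%:R * D)| <= a * (d%:R ^+ 2 + d%:R) * y.
  rewrite normrM ger0_norm ?mulr_ge0//.
  apply: le_trans (ler_wpM2l (mulr_ge0 a0 L0) wd) _.
  have -> : a * L * ((d%:R ^+ 2 + d%:R) * (y * y)) =
      a * (d%:R ^+ 2 + d%:R) * y * (L * y) by ring.
  by rewrite ler_piMr// !mulr_ge0 ?addr_ge0 ?exprn_ge0// ltW.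
have t2 : `|e * w| <= C * d%:R * y.
  have w0 : 0 <= w.
    rewrite subr_ge0 exprn_ile1// ?subr_ge0 ?gerBl//; last exact: ltW.
    exact: le_trans y1.
  rewrite normrM (ger0_norm w0) -mulrA ler_pM// .
  by apply: (@le_trans _ _ (d%:R * x)); [rewrite /w; lra | rewrite ler_wpM2l].
have t3 : `|b * D ^+ 2| <= b * y.
  have D0 : 0 <= D by lra.
  rewrite ger0_norm ?mulr_ge0// ler_wpM2l//.
  by rewrite expr2 -[leRHS]mulr1; apply: ler_pM => //; exact: le_trans y1.
apply: le_trans (ler_normB _ _) _; apply: le_trans (lerD (ler_normD _ _) (lexx _)) _.
apply: le_trans (lerD (lerD t1 t2) t3) _.
by rewrite /C3 -/y -!mulrDl.
Qed.

Lemma partial_summation : exists C' : R, forall N, (0 < N)%N ->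
  `|S N - b * ln N%:R ^+ 2| <= C' * ln (Num.max (expR 1) N%:R).
Proof.
have b0 : 0 <= b by rewrite /b divr_ge0// mulr_ge0.
have C30 : 0 <= C3 by rewrite /C3 !addr_ge0// mulr_ge0// addr_ge0// exprn_ge0.
(* With l = ln max(e, N) >= 1: [T 1] starts the telescoping, the harmonic sum is at most 1 + ln N <=
   2 l, and A N / N^d is at most (C + a) l in absolute value. *)
exists (`|T 1| + 2 * C3 + C + a) => N N0.
have hT : `|T N - b * ln N%:R ^+ 2| <= `|T 1| + C3 * \sum_(1 <= k < N) k%:R^-1.
  elim: N N0 => // -[_ _|N IH _].
    by rewrite big_geq// ln1 expr0n/= !mulr0 subr0 addr0.
  rewrite big_nat_recr//= mulrDr addrA.
  rewrite (_ : _ - _ = (T N.+1 - b * ln N.+1%:R ^+ 2) +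
    (T N.+2 - T N.+1 - b * (ln N.+2%:R ^+ 2 - ln N.+1%:R ^+ 2))); last by ring.
  by apply: le_trans (ler_normD _ _) _; apply: lerD; [exact: IH | exact: T_step].
have NR : 0 < N%:R :> R by rewrite ltr0n.
have L0 : 0 <= ln N%:R :> R by rewrite ln_ge0// ler1n.
set l := ln (Num.max _ _).
have m0 : 0 < Num.max (expR 1) (N%:R : R) by rewrite lt_max NR orbT.
have l1 : 1 <= l.
  by rewrite -[leLHS]expRK ler_ln ?posrE ?expR_gt0// le_max lexx.
have lL : ln N%:R <= l by rewrite ler_ln ?posrE// le_max lexx orbT.
have hH : \sum_(1 <= k < N) k%:R^-1 <= 1 + ln N%:R :> R.
  have /andP[_] := harmonic_bounds R N; apply: le_trans.
  by rewrite big_nat_recr//= lerDl invr_ge0.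
have hAN : `|A N / N%:R ^+ d| <= a * ln N%:R + C.
  have Nd : 0 < N%:R ^+ d :> R by rewrite exprn_gt0.
  rewrite normrM normfV [X in _ / X]gtr0_norm// ler_pdivrMr//.
  have aL : 0 <= a * N%:R ^+ d * ln N%:R by rewrite !mulr_ge0// ltW.
  have := le_trans (lerB_dist _ _) (hA N0).
  by rewrite (ger0_norm aL) lerBlDl mulrDl [a * _ * _ in X in _ -> X]mulrAC.
have -> : S N - b * ln N%:R ^+ 2 = (T N - b * ln N%:R ^+ 2) + A N / N%:R ^+ d.
  by rewrite /T; ring.
apply: le_trans (ler_normD _ _) _; apply: le_trans (lerD hT hAN) _.
have h1 : C3 * \sum_(1 <= k < N) k%:R^-1 <= C3 * (2 * l) by rewrite ler_wpM2l//; lra.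
have h2 : a * ln N%:R <= a * l by rewrite ler_wpM2l.
have h3 : `|T 1| <= `|T 1| * l by rewrite ler_peMr.
have h4 : C <= C * l by rewrite ler_peMr.
rewrite (_ : _ * l = `|T 1| * l + C3 * (2 * l) + (a * l + C * l)); last by ring.
by apply: lerD; apply: lerD.
Qed.

End PartialSummation.

(** * The second sum and the conclusion *)

(** Splits off the shell of norm N+1, on which the weight of the second sum is constant; this yields
    the increment relation required by partial summation. *)
Lemma sum_box_recr (R : realType) (d N : nat) (G : 'rV[int]_d -> R) :
  \sum_(n <- box d N.+1 | n != 0) G n = \sum_(n <- box d N | n != 0) G n +
    \sum_(n <- box d N.+1 | (n != 0) && (supnorm n == N.+1)) G n.
Proof.
rewrite (bigID (fun n => supnorm n == N.+1))/= addrC; congr (_ + _).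
rewrite -big_filter -[RHS]big_filter; apply/perm_big/uniq_perm.
- by rewrite filter_uniq ?box_uniq.
- by rewrite filter_uniq ?box_uniq.
by move=> n; rewrite !mem_filter !mem_box -andbA; congr (_ && _); rewrite -ltn_neqAle ltnS.
Qed.

Theorem theorem7 (R : realType) (d : nat) (hd : (1 <= d)%N)
    (alpha : 'rV[R]_d) (halpha : badly_approximable alpha) :
  (exists C : R, forall N : nat, (1 <= N)%N ->
    `| (\sum_(n \in box0 d N) (dist_int (linform alpha n))^-1)
       - d%:R * 2 ^+ d.+1 * N%:R ^+ d * ln N%:R |
    <= C * N%:R ^+ d) /\
  (exists C : R, forall N : nat, (1 <= N)%N ->
    `| (\sum_(n \in box0 d N)
          ((supnorm n)%:R ^+ d * dist_int (linform alpha n))^-1)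
       - d%:R ^+ 2 * 2 ^+ d * ln N%:R ^+ 2 |
    <= C * ln (Num.max (expR 1) N%:R)).
Proof.
have [Q Q0 ws] := badly_approximable_well_spaced halpha.
have [C hC] := sum_dist_int_inv hd ws Q0.
split; first by exists C => N N0; rewrite sum_box0; exact: hC.
pose A N := \sum_(n <- box d N | n != 0) (dist_int (linform alpha n))^-1.
pose S N := \sum_(n <- box d N | n != 0)
  ((supnorm n)%:R ^+ d * dist_int (linform alpha n))^-1.
have hS N : (0 < N)%N -> S N.+1 - S N = (A N.+1 - A N) / N.+1%:R ^+ d.
  move=> _; rewrite /S /A !sum_box_recr ![_ + _ - _]addrAC !subrr !add0r mulr_suml.
  by apply: eq_bigr => n /andP[_ /eqP ->]; rewrite invfM mulrC.
have a0 : 0 <= d%:R * 2 ^+ d.+1 :> R by rewrite mulr_ge0// exprn_ge0.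
have [C' hC'] := partial_summation a0 hC hS.
exists C' => N N0; rewrite sum_box0.
(* The right-hand side is the coefficient a d / 2 for a = d 2^(d+1). *)
rewrite (_ : d%:R ^+ 2 * 2 ^+ d = d%:R * 2 ^+ d.+1 * d%:R / 2); first exact: hC'.
by rewrite [2 ^+ d.+1]exprS; field.
Qed.
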